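(* Let $\mathcal N$ be an admissible algebra of nil-index $\nu(\mathcal N)$ with pointing $\omega$, let $W$ be a vector space, $\phi:W\to\ker(\omega)$ a linear isomorphism, and let $\mathbf p=\omega\circ\exp_2\circ\phi\in\mathbb F[W]$ be the corresponding nil-polynomial. With $\omega_2,\omega_3$, the product $x\cdot y$ on $W$ and the linear isomorphism $\psi:\mathbb F\to\mathcal N_{[1]}$ defined in the context, equip $W\oplus\mathbb F$ with the commutative product $$(x,s)(y,t):=(x\cdot y,\,\omega_2(x,y)).$$ With respect to this product the linear map $$W\oplus\mathbb F\to\mathcal N,\qquad(x,s)\mapsto\phi(x)+\psi(s),$$ is an isomorphism of algebras. In particular, $W$ with product $x\cdot y$ is isomorphic to the nilpotent algebra $\mathcal N/\mathcal N_{[1]}$ and has nil-index $\nu(\mathcal N)-1$.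
   Context: $\mathbb F$ is a field of characteristic $0$; all algebras are associative $\mathbb F$-algebras. For an algebra $\mathcal N$ put $\mathcal N^1=\mathcal N$ and let $\mathcal N^{k+1}$ be the linear span of $\mathcal N\mathcal N^k$; $\mathcal N$ is nilpotent if $\mathcal N^{k+1}=0$ for some $k\ge0$, and the minimal such $k$ is the nil-index. An admissible algebra is a commutative nilpotent algebra $\mathcal N$ of finite dimension over $\mathbb F$ whose annihilator $\mathcal N_{[1]}=\{x\in\mathcal N:x\mathcal N=0\}$ has dimension $1$. A pointing on $\mathcal N$ is a linear form $\omega:\mathcal N\to\mathbb F$ with $\omega(\mathcal N_{[1]})=\mathbb F$. $\exp_2(x)=\sum_{k\ge2}x^k/k!$. The symmetric $k$-linear form $\omega_k$ on $W$ is $\omega_k(x_1,\dots,x_k)=\omega\big((\phi x_1)\cdots(\phi x_k)\big)$; $\omega_2$ is non-degenerate. The product $x\cdot y$ on $W$ is defined by $\omega_2(x\cdot y,z)=\omega_3(x,y,z)$ for all $z\in W$. With $\mathcal K:=\ker(\omega)$, $\psi:\mathbb F\to\mathcal N_{[1]}$ is the unique linear isomorphism such that $\psi\circ\omega$ is the canonical projection $\mathcal N=\mathcal K\oplus\mathcal N_{[1]}\to\mathcal N_{[1]}$. *)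

(* Defs.v *)
From HB Require Import structures.
From mathcomp Require Import all_boot all_order all_algebra.

Set Implicit Arguments.
Unset Strict Implicit.
Unset Printing Implicit Defensive.

Import GRing.Theory.
Local Open Scope ring_scope.
Local Open Scope quotient_scope.

(* Nilpotent algebras have no unit, so they are not ring structures of the
   algebraic hierarchy: an algebra is a vector space with a product [mul]. *)

Section Algebra.
Variables (F : fieldType) (A : lmodType F) (mul : A -> A -> A).

Record is_algebra : Prop := IsAlgebra {
  alg_linearl : forall y, linear (mul^~ y);
  alg_linearr : forall x, linear (mul x);
  alg_assoc : associative mul }.

(* [linspan S] is the linear span of [S]. *)
Inductive linspan (S : A -> Prop) : A -> Prop :=
| linspan0 : linspan S 0
| linspanD (a : F) (u v : A) : S u -> linspan S v -> linspan S (a *: u + v).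

(* Indices are shifted by one: [algpow k] is the (k+1)-st power of the algebra,
   so [algpow 0] is the algebra itself. *)
Fixpoint algpow (k : nat) : A -> Prop :=
  if k is k'.+1
  then linspan (fun z => exists x y, algpow k' y /\ z = mul x y)
  else fun=> True.

Definition nilpotent_at (k : nat) : Prop := forall z, algpow k z -> z = 0.

Definition nilpotent_algebra : Prop := exists k, nilpotent_at k.

Definition nil_index (nu : nat) : Prop :=
  nilpotent_at nu /\ forall k, nilpotent_at k -> (nu <= k)%N.

(* The power x^k of an element, for k >= 1; there is no x^0. *)
Definition elpow (x : A) (k : nat) : A := iter k.-1 (mul x) x.

(* The series of exp_2 is cut at [nu]; for [mul] of nil-index [nu] all the
   omitted terms vanish. *)
Definition exp2 (nu : nat) (x : A) : A :=
  \sum_(2 <= k < nu.+1) (k`!%:R : F)^-1 *: elpow x k.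

End Algebra.

Record algebra_iso (F : fieldType) (A B : lmodType F) (mulA : A -> A -> A)
    (mulB : B -> B -> B) (f : A -> B) : Prop := AlgebraIso {
  algebra_iso_dom : is_algebra mulA;
  algebra_iso_codom : is_algebra mulB;
  algebra_iso_linear : linear f;
  algebra_iso_bij : bijective f;
  algebra_iso_mul : {morph f : x y / mulA x y >-> mulB x y} }.

Section Annihilator.
Variables (F : fieldType) (N : vectType F) (mul : N -> N -> N).

(* The kernel of x |-> (y |-> x y); see [annP]. *)
Definition ann : {vspace N} := lker (linfun (fun x => linfun (mul x))).

Lemma annP (x : N) : is_algebra mul ->
  reflect (forall y, mul x y = 0) (x \in ann).
Proof.
case=> linl linr _.
pose R z := GRing.isLinear.Build F N N *:%R (mul z) (linr z).
pose mulr z : {linear N -> N} := HB.pack (mul z) (R z).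
have mulrE z y : linfun (mul z) y = mul z y by apply: (lfunE (mulr z)).
pose L := GRing.isLinear.Build F N 'End(N) *:%R (fun z => linfun (mul z)).
have linL : linear (fun z => linfun (mul z)).
  by move=> a u v; apply/lfunP=> y; rewrite add_lfunE scale_lfunE !mulrE linl.
pose mull : {linear N -> 'End(N)} := HB.pack (fun z => linfun (mul z)) (L linL).
have mullE z : linfun (fun z => linfun (mul z)) z = linfun (mul z).
  exact: (lfunE mull).
rewrite memv_ker mullE; apply: (iffP eqP) => [x0 y | x0].
  by rewrite -mulrE x0 lfunE.
by apply/lfunP=> y; rewrite mulrE lfunE /= x0.
Qed.

Record admissible : Prop := Admissible {
  adm_algebra : is_algebra mul;
  adm_comm : commutative mul;
  adm_nilpotent : nilpotent_algebra mul;
  adm_ann : \dim ann = 1%N }.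

Definition pointing (omega : 'Hom(N, F^o)) : Prop := (omega @: ann)%VS = fullv.

End Annihilator.

Section VectorQuotient.
Variables (F : fieldType) (V : vectType F) (U : {vspace V}).

Definition vquot := Quotient.quot (pred_of_vspace U : zmodClosed V).

HB.instance Definition _ := EqQuotient.on vquot.
HB.instance Definition _ := GRing.Zmodule.on vquot.
HB.instance Definition _ := ZmodQuotient.on vquot.

Definition vquot_scale (a : F) : vquot -> vquot := lift_op1 vquot ( *:%R a).

Lemma pi_vquot_scale a : {morph \pi_vquot : x / a *: x >-> vquot_scale a x}.
Proof.
move=> x; unlock vquot_scale; apply/eqP.
by rewrite -Quotient.idealrBE -scalerBr memvZ // Quotient.idealrBE reprK.
Qed.

Lemma vquot_scaleA a b x : vquot_scale a (vquot_scale b x) = vquot_scale (a * b) x.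
Proof. by elim/quotW: x => x; rewrite -!pi_vquot_scale scalerA. Qed.
Lemma vquot_scale1 : left_id 1 vquot_scale.
Proof. by elim/quotW=> x; rewrite -pi_vquot_scale scale1r. Qed.
Lemma vquot_scaleDr : right_distributive vquot_scale +%R.
Proof.
move=> a; elim/quotW=> x; elim/quotW=> y.
by rewrite -!pi_vquot_scale -raddfD -pi_vquot_scale scalerDr raddfD.
Qed.
Lemma vquot_scaleDl x : {morph vquot_scale^~ x : a b / a + b}.
Proof.
by move=> a b; elim/quotW: x => x; rewrite -!pi_vquot_scale -raddfD scalerDl.
Qed.

HB.instance Definition _ := GRing.Zmodule_isLmodule.Build F vquot
  vquot_scaleA vquot_scale1 vquot_scaleDr vquot_scaleDl.

End VectorQuotient.

(* The product induced on V / U; well defined as soon as U is an ideal, see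
   [pi_vquot_mul]. *)
Definition vquot_mul (F : fieldType) (V : vectType F) (mul : V -> V -> V)
    (U : {vspace V}) : vquot U -> vquot U -> vquot U :=
  lift_op2 (vquot U) mul.

Lemma pi_vquot_mul (F : fieldType) (V : vectType F) (mul : V -> V -> V)
    (U : {vspace V}) : is_algebra mul ->
  (forall x y, x \in U -> mul x y \in U) ->
  (forall x y, y \in U -> mul x y \in U) ->
  {morph \pi_(vquot U) : x y / mul x y >-> vquot_mul mul x y}.
Proof.
case=> linl linr _ Ul Ur x y; unlock vquot_mul; apply/eqP.
rewrite -Quotient.idealrBE.
set x' := repr _; set y' := repr _.
have Ux : x - x' \in U by rewrite Quotient.idealrBE reprK.
have Uy : y - y' \in U by rewrite Quotient.idealrBE reprK.
have -> : mul x y - mul x' y' = mul (x - x') y + mul x' (y - y').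
  have -> : x - x' = -1 *: x' + x by rewrite scaleN1r addrC.
  have -> : y - y' = -1 *: y' + y by rewrite scaleN1r addrC.
  by rewrite linl linr !scaleN1r addrACA addrC addrA addrK.
by apply: rpredD; [apply: Ul | apply: Ur].
Qed.

Section NilPolynomial.
Variables (F : fieldType) (N : vectType F) (mul : N -> N -> N).
Variables (omega : 'Hom(N, F^o)) (W : lmodType F).
Variable phi : W -> subvs_of (lker omega).

Definition nil_polynomial (nu : nat) (x : W) : F :=
  omega (exp2 mul nu (vsval (phi x))).

Definition omega2 (x y : W) : F := omega (mul (vsval (phi x)) (vsval (phi y))).

Definition omega3 (x y z : W) : F :=
  omega (mul (mul (vsval (phi x)) (vsval (phi y))) (vsval (phi z))).

Definition is_nil_product (dot : W -> W -> W) : Prop :=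
  forall x y z, omega2 (dot x y) z = omega3 x y z.

(* [daddv_pi U V] is the projection onto U along V. The condition determines
   [psi], since a pointing [omega] is onto. *)
Definition is_ann_coordinate (psi : F^o -> subvs_of (ann mul)) : Prop :=
  [/\ linear psi, bijective psi
    & forall x, vsval (psi (omega x)) = daddv_pi (ann mul) (lker omega) x].

Definition pair_mul (dot : W -> W -> W) (u v : W * F^o) : W * F^o :=
  (dot u.1 v.1, omega2 u.1 v.1).

Definition pair_map (psi : F^o -> subvs_of (ann mul)) (u : W * F^o) : N :=
  vsval (phi u.1) + vsval (psi u.2).

End NilPolynomial.

Arguments is_ann_coordinate {F N} mul omega psi.
Arguments vquot_mul {F V} mul U.

(* The conditions [is_nil_product] and [is_ann_coordinate] are satisfiable. *)
Section WellDefined.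
Variables (F : fieldType) (N : vectType F) (mul : N -> N -> N).
Variable omega : 'Hom(N, F^o).
Hypotheses (admN : admissible mul) (omega_pt : pointing mul omega).

Lemma pointing_unit : exists2 v, v \in ann mul & omega v = 1.
Proof.
have : (1 : F^o) \in (omega @: ann mul)%VS by rewrite omega_pt memvf.
by case/memv_imgP=> v annv ->; exists v.
Qed.

Lemma omegaP (a : F) u v : omega (a *: u + v) = a * omega u + omega v.
Proof. exact: linearP. Qed.
Lemma omegaZ (a : F) u : omega (a *: u) = a * omega u.
Proof. exact: linearZ. Qed.

Lemma nil_product_exists (W : lmodType F) (phi : W -> subvs_of (lker omega)) :
  bijective phi -> exists dot, is_nil_product mul phi dot.
Proof.
case=> g _ gK; have [v annv omv] := pointing_unit.
have algN := adm_algebra admN; have [linl linr _] := algN.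
pose m x y := mul (vsval (phi x)) (vsval (phi y)).
exists (fun x y => g (vsproj (lker omega) ((- omega (m x y) : F) *: v + m x y))) => x y z.
rewrite /omega2 gK vsprojK; last first.
  by rewrite memv_ker omegaP omv mulr1 addNr.
by rewrite linl (annP v algN annv) scaler0 add0r.
Qed.

Lemma ann_coordinate_exists : exists psi, is_ann_coordinate mul omega psi.
Proof.
have [v annv omv] := pointing_unit.
have v0 : v != 0 by apply: contra_eq_neq omv => ->; rewrite linear0 eq_sym oner_eq0.
have annE : ann mul = <[v]>%VS.
  by apply/esym/eqP; rewrite eqEdim -memvE annv (adm_ann admN) dim_vline v0.
have capK : (ann mul :&: lker omega)%VS = 0%VS.
  apply/eqP; rewrite -subv0; apply/subvP=> x; rewrite memv_cap annE memv0.
  case/andP=> /vlineP[c ->]; rewrite memv_ker omegaZ omv.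
  by rewrite mulr1 => /eqP ->; rewrite scale0r.
exists (fun c : F^o => vsproj (ann mul) ((c : F) *: v)); split.
- by move=> a b c; rewrite scalerDl -scalerA linearP.
- exists (fun u => omega (vsval u)) => [c | u].
    by rewrite vsprojK ?memvZ // omegaZ omv mulr1.
  apply/val_inj; rewrite /= vsprojK ?memvZ //.
  have /vlineP[c ->] : vsval u \in <[v]>%VS by rewrite -annE subvsP.
  by rewrite omegaZ omv mulr1.
move=> x; rewrite vsprojK ?memvZ //.
set c := (omega x : F).
have capK' : (lker omega :&: ann mul)%VS = 0%VS by rewrite capvC.
have Kw : x - c *: v \in lker omega.
  by rewrite memv_ker addrC -scaleNr omegaP omv mulr1 addNr.
have piw : daddv_pi (ann mul) (lker omega) (x - c *: v) = 0.
  have := daddv_pi_add capK (subvP (addvSr _ _) _ Kw).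
  by rewrite (daddv_pi_id capK' Kw) => /(canRL (addrK _)); rewrite subrr.
by rewrite -[x in RHS](subrK (c *: v)) linearD /= piw add0r daddv_pi_id ?memvZ.
Qed.

End WellDefined.

(* Main.v *)
Require Import Defs.
From Corelib Require Import Setoid.
From HB Require Import structures.
From mathcomp Require Import all_boot all_order all_algebra.

Set Implicit Arguments.
Unset Strict Implicit.
Unset Printing Implicit Defensive.

Import GRing.Theory.
Local Open Scope ring_scope.

(* Nilpotence and [\dim ann = 1] make every nonzero ideal of [N] meet the
   annihilator in all of it, where [omega] does not vanish. Hence an [n] with
   [omega (n N) = 0] lies in the annihilator. Applied to the difference of
   [phi (dot x y)] and [phi x * phi y], this yields
   [phi x * phi y = phi (dot x y) + psi (omega2 x y)]; the algebra axioms for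
   both products on the [W] side are then transported along the isomorphisms.
   The nil-index drops by one because [N ^ k] lies in the annihilator exactly
   when [N ^ k.+1 = 0]. *)

(** * Algebra axioms, powers and nilpotence along linear multiplicative maps *)

Section Transport.
Variables (F : fieldType) (A B : lmodType F).
Variables (mulA : A -> A -> A) (mulB : B -> B -> B) (f : A -> B).
Hypotheses (linf : linear f) (fM : {morph f : x y / mulA x y >-> mulB x y}).

Lemma linear_image0 : f 0 = 0.
Proof. by have := linf (-1) 0 0; rewrite scaler0 addr0 scaleN1r addNr. Qed.

Lemma is_algebra_surj : (forall b, exists a, f a = b) ->
  is_algebra mulA -> is_algebra mulB.
Proof.
move=> surj [linl linr mulAA]; split.
- move=> y a u v; have [y' <-] := surj y; have [u' <-] := surj u.
  by have [v' <-] := surj v; rewrite -linf -!fM linl linf.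
- move=> x a u v; have [x' <-] := surj x; have [u' <-] := surj u.
  by have [v' <-] := surj v; rewrite -linf -!fM linr linf.
- move=> x y z; have [x' <-] := surj x; have [y' <-] := surj y.
  by have [z' <-] := surj z; rewrite -!fM mulAA.
Qed.

(** Pulls the axioms back to the products on [W] and on pairs, about which nothing is assumed in
    advance. *)
Lemma is_algebra_inj : injective f -> is_algebra mulB -> is_algebra mulA.
Proof.
move=> injf [linl linr mulBA]; split.
- by move=> y a u v; apply: injf; rewrite fM !linf linl !fM.
- by move=> x a u v; apply: injf; rewrite fM !linf linr !fM.
- by move=> x y z; apply: injf; rewrite !fM mulBA.
Qed.

Lemma algpow_image k a : algpow mulA k a -> algpow mulB k (f a).
Proof.
elim: k a => [//|k IHk] a /=; elim=> [|c u v [x [y [yk ->]]] _ IHv].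
  by rewrite linear_image0; constructor.
by rewrite linf; constructor => //; exists (f x), (f y); rewrite fM; split=> //; apply: IHk.
Qed.

Lemma algpow_preimage k b : (forall b, exists a, f a = b) ->
  algpow mulB k b -> exists2 a, algpow mulA k a & f a = b.
Proof.
move=> surj; elim: k b => [|k IHk] b /=; first by have [a] := surj b; exists a.
elim=> [|c u v [x [y [yk ->]]] _ [v' v'k <-]].
  by exists 0; [constructor | exact: linear_image0].
have [x' <-] := surj x; have [y' y'k <-] := IHk y yk.
exists (c *: mulA x' y' + v'); last by rewrite linf fM.
by constructor=> //; exists x', y'.
Qed.

(** Powers map onto powers because both factors of a product lift. For a quotient map, nilpotence
    thus becomes a condition on the kernel. *)
Lemma nilpotent_at_surj k : (forall b, exists a, f a = b) ->
  nilpotent_at mulB k <-> forall a, algpow mulA k a -> f a = 0.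
Proof.
move=> surj; split=> [nilB a ak | kerf b /(algpow_preimage surj)[a ak <-]].
  exact/nilB/algpow_image.
exact: kerf.
Qed.

Lemma nilpotent_at_bij k :
  bijective f -> nilpotent_at mulA k <-> nilpotent_at mulB k.
Proof.
case=> g fK gK; have surj b : exists a, f a = b by exists (g b).
rewrite nilpotent_at_surj //; split=> nil a ak; first by rewrite (nil a ak) linear_image0.
by apply: (can_inj fK); rewrite linear_image0 nil.
Qed.

End Transport.

(** * The annihilator and the powers of the algebra *)

Section Annihilator.
Variables (F : fieldType) (N : vectType F) (mul : N -> N -> N).
Hypotheses (algN : is_algebra mul) (mulC : commutative mul).

Lemma algebra_mul0 x : mul x 0 = 0.
Proof. exact: linear_image0 (alg_linearr algN x). Qed.

Lemma algebra_mulN x y : mul x (- y) = - mul x y.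
Proof.
have := alg_linearr algN x (-1) y 0.
by rewrite algebra_mul0 !addr0 !scaleN1r.
Qed.

Lemma algebra_mulD x y z : mul x (y + z) = mul x y + mul x z.
Proof. by have := alg_linearr algN x 1 y z; rewrite !scale1r. Qed.

Lemma ann_mull x y : x \in ann mul -> mul x y = 0.
Proof. by move/(annP _ algN). Qed.

Lemma ann_mulr x y : y \in ann mul -> mul x y = 0.
Proof. by rewrite mulC; apply: ann_mull. Qed.

Lemma pi_ann_mul :
  {morph \pi_(vquot (ann mul)) : x y / mul x y >-> vquot_mul mul (ann mul) x y}%qT.
Proof.
by apply: (pi_vquot_mul algN) => x y ann_xy;
  [rewrite ann_mull | rewrite ann_mulr]; rewrite ?mem0v.
Qed.

Lemma nilpotent_at_ann k :
  nilpotent_at mul k.+1 <-> forall x, algpow mul k x -> x \in ann mul.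
Proof.
split=> [nil x xk | kann x /=]; last first.
  elim=> [//|c u v [y [z [/kann annz ->]]] _ ->].
  by rewrite ann_mulr // scaler0 addr0.
apply/annP => // y; rewrite mulC; apply: nil => /=.
(* A single product enters the span as the combination [1 *: mul y x + 0]. *)
rewrite -[mul y x]addr0 -[mul y x]scale1r.
by constructor; [exists y, x | constructor].
Qed.

End Annihilator.

Section VectorQuotient.
Variables (F : fieldType) (V : vectType F) (U : {vspace V}).
Local Open Scope quotient_scope.

Lemma pi_vquot_linear : linear (\pi_(vquot U) : V -> vquot U).
Proof. by move=> a x y; rewrite raddfD; congr (_ + _); apply: pi_vquot_scale. Qed.

Lemma pi_vquot_eq x y : (\pi_(vquot U) x = \pi_(vquot U) y) <-> x - y \in U.
Proof. by rewrite Quotient.idealrBE; split=> [/eqP|/eqP]. Qed.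

Lemma pi_vquot_surj (b : vquot U) : exists a, \pi_(vquot U) a = b.
Proof. by exists (repr b); rewrite reprK. Qed.

End VectorQuotient.

(** * The splitting of [N] by [omega] and the product on [W] *)

Section NilPolynomial.
Variables (F : fieldType) (N : vectType F) (mul : N -> N -> N) (nu : nat).
Hypotheses (admN : admissible mul) (nuN : nil_index mul nu).
Variable omega : 'Hom(N, F^o).
Hypothesis omega_pt : pointing mul omega.

Let algN := adm_algebra admN.
Let mulC := adm_comm admN.

Lemma nil_index_gt0 : (0 < nu)%N.
Proof.
case: nuN => nil0 _; rewrite lt0n; apply/eqP => nu0.
have := adm_ann admN; suff -> : ann mul = 0%VS by rewrite dimv0.
apply/eqP; rewrite -subv0; apply/subvP=> x _.
by rewrite memv0; apply/eqP/nil0; rewrite nu0.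
Qed.

(** Rank-nullity: [omega] maps the one-dimensional annihilator onto a line. *)
Lemma pointing_capK : (ann mul :&: lker omega)%VS = 0%VS.
Proof.
apply/eqP; rewrite -dimv_eq0 -(eqn_add2r (\dim (omega @: ann mul))).
by rewrite limg_ker_dim (adm_ann admN) omega_pt dimvf.
Qed.

Lemma ann_omega0 x : x \in ann mul -> omega x = 0 -> x = 0.
Proof.
move=> annx wx; apply/eqP; rewrite -memv0 -pointing_capK memv_cap annx.
by rewrite memv_ker wx eqxx.
Qed.

Lemma omega_mul0_ann n : (forall y, omega (mul n y) = 0) -> n \in ann mul.
Proof.
move=> wn.
(* Climb from the zero power [algpow mul nu] ([j = 0]) to all of [N] ([j = nu]), showing that [n]
   kills each power. *)
suff mul0 j : (j <= nu)%N -> forall z, algpow mul (nu - j) z -> mul n z = 0.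
  by apply/annP => // y; apply: (mul0 nu) => //; rewrite subnn.
elim: j => [_ z|j IHj ltj z zk].
  by rewrite subn0 => /nuN.1 ->; apply: algebra_mul0.
(* Since [n z] has [omega]-value zero, it vanishes once it annihilates every [y]; and
   [(n z) y = n (y z)], where [y z] lies in the next power, already killed by [n]. *)
apply: ann_omega0 (wn z); apply/annP => // y.
rewrite -(alg_assoc algN) (mulC z); apply: IHj (ltnW ltj) _ _.
rewrite -subSS subSn //= -[mul y z]addr0 -[mul y z]scale1r.
by constructor; [exists y, z | constructor].
Qed.

Variable psi : F^o -> subvs_of (ann mul).
Hypothesis psiP : is_ann_coordinate mul omega psi.

Lemma psi_omega x : x \in ann mul -> vsval (psi (omega x)) = x.
Proof. by case: psiP => _ _ -> annx; rewrite daddv_pi_id ?pointing_capK. Qed.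

Lemma mul_add_psi x y s : mul x (y + vsval (psi s)) = mul x y.
Proof.
by rewrite algebra_mulD // [X in _ + X](ann_mulr algN mulC) ?subvsP // addr0.
Qed.

(** [psi] is injective, and [psi \o omega] fixes the value [psi s], which lies in the
    annihilator. *)
Lemma omega_psi s : omega (vsval (psi s)) = s.
Proof.
case: (psiP) => _ /bij_inj injpsi _; apply/injpsi/val_inj.
exact: psi_omega (subvsP _).
Qed.

Variables (W : lmodType F) (phi : W -> subvs_of (lker omega)).
Hypotheses (phi_lin : linear phi) (phi_bij : bijective phi).

Lemma omega_phi x : omega (vsval (phi x)) = 0.
Proof. by apply/eqP; rewrite -memv_ker subvsP. Qed.

Lemma pair_map_linear : linear (pair_map phi psi).
Proof.
case: psiP => psi_lin _ _ a x y; rewrite /pair_map /= phi_lin psi_lin.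
by rewrite !linearP scalerDr addrACA.
Qed.

Lemma pair_map_bij : bijective (pair_map phi psi).
Proof.
case: phi_bij => g phiK gK.
(* The inverse splits [n] into its annihilator part [psi (omega n)] and a remainder in the kernel of
   [omega]. *)
exists (fun n : N =>
  (g (vsproj (lker omega) (n - vsval (psi (omega n)))), omega n)) => [[x s]|n].
  rewrite /pair_map /= [omega _]linearD /= omega_phi omega_psi add0r addrK.
  by rewrite vsvalK phiK.
rewrite /pair_map /= gK vsprojK ?subrK //.
by rewrite memv_ker linearB /= omega_psi subrr.
Qed.

Variables (dot : W -> W -> W) (dotP : is_nil_product mul phi dot).

Lemma mul_phi x y :
  mul (vsval (phi x)) (vsval (phi y)) = vsval (phi (dot x y)) + vsval (psi (omega2 mul phi x y)).
Proof.
set xy := mul _ _.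
have annd : xy - vsval (phi (dot x y)) \in ann mul.
  apply: omega_mul0_ann => n.
  (* Write [n] as [phi w + psi s]: products with [psi s] vanish, and what remains is the defining
     equation of [dot] at [w]. *)
  have [g _ gK] := pair_map_bij; rewrite -(gK n) /pair_map.
  rewrite mul_add_psi.
  rewrite mulC algebra_mulD // algebra_mulN // linearB /= -/xy.
  apply/eqP; rewrite subr_eq0 mulC [X in _ == omega X]mulC; apply/eqP/esym.
  exact: dotP.
apply/eqP; rewrite addrC -subr_eq; apply/eqP.
by rewrite -[LHS]psi_omega // [omega _]linearB /= omega_phi subr0.
Qed.

Lemma pair_map_mul :
  {morph pair_map phi psi : u v / pair_mul mul phi dot u v >-> mul u v}.
Proof.
move=> u v; rewrite /pair_map /= -mul_phi mul_add_psi.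
by rewrite [RHS]mulC mul_add_psi mulC.
Qed.

End NilPolynomial.

Theorem mainTheorem14 (F : fieldType) (charF : [pchar F] =i pred0)
  (N : vectType F) (mul : N -> N -> N) (nu : nat)
  (admN : admissible mul) (nuN : nil_index mul nu)
  (omega : 'Hom(N, F^o)) (omega_pt : pointing mul omega)
  (W : lmodType F)
  (phi : W -> subvs_of (lker omega)) (phi_lin : linear phi)
  (phi_bij : bijective phi)
  (p : W -> F) (p_def : forall x, p x = nil_polynomial mul phi nu x)
  (dot : W -> W -> W) (dotP : is_nil_product mul phi dot)
  (psi : F^o -> subvs_of (ann mul)) (psiP : is_ann_coordinate mul omega psi) :
  [/\ commutative (pair_mul mul phi dot),
      algebra_iso (pair_mul mul phi dot) mul (pair_map phi psi),
      exists f : W -> vquot (ann mul),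
        algebra_iso dot (vquot_mul mul (ann mul)) f,
      nilpotent_algebra (vquot_mul mul (ann mul))
    & nil_index dot (nu - 1)].
Proof.
have [algN mulC] := (adm_algebra admN, adm_comm admN).
have gM := pair_map_mul admN nuN omega_pt psiP phi_bij dotP.
have g_lin := pair_map_linear psiP phi_lin.
have g_bij := pair_map_bij admN omega_pt psiP phi_bij.
have pi_lin := @pi_vquot_linear F N (ann mul).
have piM := pi_ann_mul algN mulC.
have pi_surj := @pi_vquot_surj F N (ann mul).
have algQ := is_algebra_surj pi_lin piM pi_surj algN.
pose f x := (\pi_(vquot (ann mul)) (vsval (phi x)))%qT.
have f_lin : linear f by move=> a x y; rewrite /f phi_lin linearP pi_lin.
have fM : {morph f : x y / dot x y >-> vquot_mul mul (ann mul) x y}.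
  (* The two representatives differ by a value of [psi], hence by an element of the annihilator. *)
  move=> x y; rewrite /f -piM; apply/pi_vquot_eq.
  by rewrite (mul_phi admN nuN omega_pt psiP phi_bij dotP) opprD addNKr rpredN subvsP.
have f_bij : bijective f.
  have [h phiK hK] := phi_bij.
  (* [q n] is the [W]-component of [n]; removing the annihilator part does not change the class. *)
  pose q n := h (vsproj (lker omega) (n - vsval (psi (omega n)))).
  have phi_q n : vsval (phi (q n)) = n - vsval (psi (omega n)).
    by rewrite hK vsprojK // memv_ker linearB /= (omega_psi admN omega_pt psiP) subrr.
  have f_q n : (f (q n) = \pi_(vquot (ann mul)) n)%qT.
    by apply/pi_vquot_eq; rewrite phi_q addrAC subrr add0r rpredN subvsP.
  exists (q \o repr) => [x|b]; last by rewrite /= f_q reprK.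
  (* The two elements have equal classes and both lie in the kernel of [omega], which meets the
     annihilator only in zero. *)
  apply/(bij_inj phi_bij)/val_inj/eqP; rewrite -subr_eq0; apply/eqP.
  apply: (ann_omega0 admN omega_pt); last by rewrite linearB /= !omega_phi subrr.
  by apply/pi_vquot_eq; rewrite -/(f _) f_q reprK.
have nilQ k : nilpotent_at (vquot_mul mul (ann mul)) k <-> nilpotent_at mul k.+1.
  rewrite (nilpotent_at_surj pi_lin piM _ pi_surj) nilpotent_at_ann //.
  have pi0 x : (\pi_(vquot (ann mul)) x = 0)%qT <-> x \in ann mul.
    by rewrite -(linear_image0 pi_lin) pi_vquot_eq subr0.
  by split=> nil x /nil /pi0.
have nil_nu := nil_index_gt0 admN nuN; have [nilN min_nu] := nuN.
have nilQ_nu : nilpotent_at (vquot_mul mul (ann mul)) (nu - 1).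
  (* Positivity of [nu] makes the truncated [nu - 1] a true predecessor. *)
  by apply/nilQ; rewrite subn1 prednK.
split.
- by move=> u v; apply: (bij_inj g_bij); rewrite !gM mulC.
- by split=> //; exact: is_algebra_inj g_lin gM (bij_inj g_bij) algN.
- by exists f; split=> //; exact: is_algebra_inj f_lin fM (bij_inj f_bij) algQ.
- by exists (nu - 1)%N.
have nilW k := nilpotent_at_bij f_lin fM k f_bij.
split=> [|k /nilW/nilQ/min_nu]; first exact/nilW.
by rewrite leq_subLR add1n.
Qed.
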